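(* Let $h>0$ and consider the discrete Poisson equation $L_h u_h=f_h$ on the infinite grid $\mathcal G_h=\{h\,\mathbf j:\mathbf j\in\mathbb Z^2\}$, where $L_h$ is the standard five-point negative Laplacian. Consider the two-level $(h,H)$ multigrid $V[\nu_1,\nu_2]$ cycle, $H=\sqrt2\,h$, consisting of: - the red-black smoother with relaxation parameter $\omega=1$; - red-black coarsening, i.e. the coarse grid $\mathcal G_H$ is the set of black points $\{h\,\mathbf j: j_1+j_2 \text{ even}\}$ (a rotated Cartesian grid with spacing $H=\sqrt2\,h$); - the transfer operators $I_h^H$ (restriction, stencil weights $\frac18$ times $4$ at the centre and $1$ at each of the four nearest neighbours) and $I_H^h$ (interpolation, weights $\frac14$ times $4$ at the centre and $1$ at each of the four nearest neighbours); - the Galerkin coarse-level operator $L_H=I_h^H L_h I_H^h$. Then this cycle is a direct solver: it converges in a single step, as long as it includes a post-smoothing step after the coarse-level correction. That is, for all integers $\nu_1\ge 0$, $\nu_2\ge 1$, every right-hand side $f_h$ and every initial guess $u_h^{(0)}$, the iterate $u_h^{(1)}$ produced by one cycle (with an exact coarse-level solve) satisfies $L_hu_h^{(1)}=f_h$.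
   Context: Write $\mathbf j=(j_1,j_2)$, $e_1=(1,0)$, $e_2=(0,1)$, and $u(\mathbf j)$ for the value of a grid function at $h\,\mathbf j$. Five-point operator: $(L_hu)(\mathbf j)=h^{-2}\big(4u(\mathbf j)-u(\mathbf j+e_1)-u(\mathbf j-e_1)-u(\mathbf j+e_2)-u(\mathbf j-e_2)\big)$. Red points: $j_1+j_2$ odd. Black points: $j_1+j_2$ even. Red-black smoother with parameter $\omega$ (one sweep): first, simultaneously at all red points, replace $u(\mathbf j)$ by $u(\mathbf j)+\frac{\omega h^2}{4}(f_h-L_hu)(\mathbf j)$, leaving black values unchanged; then do the same at all black points with the updated $u$, leaving red values unchanged. Restriction $I_h^H$ maps a function $d$ on $\mathcal G_h$ to the function on black points $(I_h^Hd)(\mathbf j)=\frac18\big(4d(\mathbf j)+d(\mathbf j\pm e_1)+d(\mathbf j\pm e_2)\big)$ (sum over all four neighbours). Interpolation $I_H^h$ maps a function $v$ on black points to the function on $\mathcal G_h$ equal to $v(\mathbf j)$ at black points and to the average of the values of $v$ at the four nearest (black) neighbours at red points. One two-level $V[\nu_1,\nu_2]$ cycle from a current approximation $u$: (1) apply $\nu_1$ smoothing sweeps to get $\bar u$; (2) compute the residual $\bar d=f_h-L_h\bar u$ and restrict it, $\bar d_H=I_h^H\bar d$; (3) exact coarse-level solve: take $v_H$ on $\mathcal G_H$ with $L_Hv_H=\bar d_H$; (4) correct: $\bar u+I_H^hv_H$; (5) apply $\nu_2$ smoothing sweeps. On the infinite grid, where $L_H$ has a nontrivial kernel, ''exact coarse-level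 solve'' means that $v_H$ is any solution of $L_Hv_H=\bar d_H$. *)

(* Defs.v *)
From HB Require Import structures.
From mathcomp Require Import all_boot all_order all_algebra.

Set Implicit Arguments.
Unset Strict Implicit.
Unset Printing Implicit Defensive.

Import Order.TTheory GRing.Theory Num.Theory.
Local Open Scope ring_scope.

(* [j : point] stands for the grid point h * j. *)
Definition point : Type := (int * int)%type.

Definition e1 : point := (1, 0).
Definition e2 : point := (0, 1).

Definition black (j : point) : bool := (2 %| j.1 + j.2)%Z.
Definition red (j : point) : bool := ~~ black j.

Definition black_point : Type := {j : point | black j}.

Definition gridfun (R : realFieldType) : Type := point -> R.
Definition coarsefun (R : realFieldType) : Type := black_point -> R.

Section Multigrid.
Variables (R : realFieldType) (h : R).
Implicit Types (u f d : gridfun R) (v : coarsefun R) (j : point).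

Definition nbr_sum u j : R :=
  u (j + e1) + u (j - e1) + u (j + e2) + u (j - e2).

Definition five_point u : gridfun R := fun j =>
  h ^- 2 * (4 * u j - u (j + e1) - u (j - e1) - u (j + e2) - u (j - e2)).

Definition residual f u : gridfun R := fun j => f j - five_point u j.

Definition relax_on (P : pred point) (omega : R) f u : gridfun R := fun j =>
  if P j then u j + omega * h ^+ 2 / 4 * residual f u j else u j.

Definition red_black_sweep (omega : R) f u : gridfun R :=
  relax_on black omega f (relax_on red omega f u).

Definition restriction d : coarsefun R := fun b =>
  8^-1 * (4 * d (val b) + nbr_sum d (val b)).

(* Extension by zero to the red points; [interpolation] evaluates it at black
   points only, since the four neighbours of a red point are black. *)
Definition extend v : gridfun R := fun j =>
  if insub j is Some b then v b else 0.

Definition interpolation v : gridfun R := fun j =>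
  if black j then extend v j else 4^-1 * nbr_sum (extend v) j.

Definition galerkin v : coarsefun R :=
  restriction (five_point (interpolation v)).

(* [galerkin] is not injective, so a cycle relates [u] to every iterate
   obtained from some solution [v] of the coarse-level equation. *)
Definition two_level_cycle (omega : R) (nu1 nu2 : nat) f u u' : Prop :=
  let ubar := iter nu1 (red_black_sweep omega f) u in
  exists v : coarsefun R,
    galerkin v =1 restriction (residual f ubar) /\
    u' =1 iter nu2 (red_black_sweep omega f)
            (fun j => ubar j + interpolation v j).

End Multigrid.

(* Main.v *)
Require Import Defs.
From HB Require Import structures.
From mathcomp Require Import all_boot all_order all_algebra.
From mathcomp Require Import zify ring.

Import Order.TTheory GRing.Theory Num.Theory.
Local Open Scope ring_scope.

(** Write [d] for the residual after the coarse-level correction; the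
coarse-level equation says that the restriction of [d] vanishes.  Relaxing the
red points with [omega = 1] annihilates the residual there and adds a quarter
of the neighbouring red residuals to each black one, so the residual at a black
point becomes [d j + nbr_sum d j / 4], which is twice the restriction of [d].
Hence the first red half-sweep already solves the equation, and whatever
smoothing follows leaves a solution unchanged. *)

Lemma blackDe1 (j : point) : black (j + e1) = ~~ black j.
Proof. by case: j => a b; rewrite /black /=; lia. Qed.

Lemma blackBe1 (j : point) : black (j - e1) = ~~ black j.
Proof. by case: j => a b; rewrite /black /=; lia. Qed.

Lemma blackDe2 (j : point) : black (j + e2) = ~~ black j.
Proof. by case: j => a b; rewrite /black /=; lia. Qed.

Lemma blackBe2 (j : point) : black (j - e2) = ~~ black j.
Proof. by case: j => a b; rewrite /black /=; lia. Qed.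

Definition black_nbrE := (blackDe1, blackBe1, blackDe2, blackBe2).

Section Smoothing.
Variables (R : realFieldType) (h : R).
Implicit Types (f u w : gridfun R) (v : coarsefun R) (j : point).

Lemma eq_five_point u w : u =1 w -> five_point h u =1 five_point h w.
Proof. by move=> uw j; rewrite /five_point !uw. Qed.

Lemma residual_eq0 f u :
  five_point h u =1 f <-> (forall j, residual h f u j = 0).
Proof.
split=> [uf j|rf j]; first by rewrite /residual uf subrr.
by apply/esym/subr0_eq/rf.
Qed.

Lemma relax_on_id (P : pred point) omega f u :
  (forall j, residual h f u j = 0) -> relax_on h P omega f u =1 u.
Proof. by move=> rf j; rewrite /relax_on rf mulr0 addr0 if_same. Qed.

Lemma relax_on_solution (P : pred point) omega f u :
  five_point h u =1 f -> five_point h (relax_on h P omega f u) =1 f.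
Proof.
move=> uf j; rewrite (eq_five_point _ u) ?uf //.
exact/relax_on_id/residual_eq0.
Qed.

Lemma iter_sweep_solution omega n f u :
  five_point h u =1 f -> five_point h (iter n (red_black_sweep h omega f) u) =1 f.
Proof. by move=> uf; elim: n => //= n IHn; do 2!apply: relax_on_solution. Qed.

(** The residual is affine in [u] and restriction is linear; the Galerkin form of the coarse
    operator makes the change exactly [galerkin v b]. *)
Lemma restriction_residual_correction f u v (b : black_point) :
  restriction (residual h f (fun j => u j + interpolation v j)) b =
  restriction (residual h f u) b - galerkin h v b.
Proof. by rewrite /galerkin /restriction /nbr_sum /residual /five_point; ring. Qed.

Hypothesis h_neq0 : h != 0.

(** The neighbours of a red point are black, hence unchanged, so the update solves the equation at
    [j] exactly. *)
Lemma residual_relax_red f u j : red j ->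
  residual h f (relax_on h red 1 f u) j = 0.
Proof.
move=> rj; have /negbTE bj := rj.
rewrite {1}/residual {1}/five_point /relax_on rj /red !black_nbrE bj /=.
by rewrite /residual /five_point; field; rewrite h_neq0.
Qed.

Lemma residual_relax_black f u (b : black_point) :
  residual h f (relax_on h red 1 f u) (val b) =
  2 * restriction (residual h f u) b.
Proof.
rewrite {1}/residual {1}/five_point /relax_on /red !black_nbrE (valP b) /=.
rewrite /restriction /nbr_sum.
(* Only the central residual is unfolded; those at the red neighbours cancel as atoms. *)
have ->: residual h f u (val b) = f (val b) - five_point h u (val b) by [].
by rewrite /five_point; field; rewrite h_neq0.
Qed.

Lemma relax_red_solution f u :
  (forall b, restriction (residual h f u) b = 0) ->
  five_point h (relax_on h red 1 f u) =1 f.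
Proof.
move=> ru; apply/residual_eq0 => j.
case: (boolP (black j)) => [bj|]; last exact: residual_relax_red.
by rewrite (residual_relax_black f u (exist _ j bj)) ru mulr0.
Qed.

End Smoothing.

Theorem theorem3 (R : realFieldType) (h : R) (nu1 nu2 : nat)
    (f u0 u1 : gridfun R) :
  0 < h -> (1 <= nu2)%N ->
  two_level_cycle h 1 nu1 nu2 f u0 u1 ->
  five_point h u1 =1 f.
Proof.
move=> h_gt0; case: nu2 => // n _ [v [coarse u1E]] j.
(* [iterSr] isolates the innermost sweep, the one applied directly to the corrected iterate. *)
rewrite (eq_five_point _ _ _ _ u1E) iterSr iter_sweep_solution // => k.
apply/relax_on_solution/relax_red_solution => [|b]; first exact: lt0r_neq0.
by rewrite restriction_residual_correction coarse subrr.
Qed.
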